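(* Let $N\in\mathbb{N}$, $\chi=\{0,\dots,N-1\}$ with the operation $x\oplus y=\max\{x,y\}$, and let $x\in\chi$. A random variable $X$ taking values in $\chi$ belongs to the domain of attraction of the degenerate law at the point $x$ if and only if $\Pr(X>x)=0$ and $\Pr(X=x)>0$.
   Context: A random variable $X$ taking values in $\chi$ is said to belong to the domain of attraction of a random variable $\xi$ (or of its law) if $X_1\oplus\cdots\oplus X_m=\max\{X_1,\dots,X_m\}$ converges in distribution to $\xi$ as $m\to\infty$, where $X_1,X_2,\dots$ are independent copies of $X$. *)

(* Defs.v *)
From HB Require Import structures.
From mathcomp Require Import all_boot all_order all_algebra finmap.
From mathcomp Require Import all_classical all_reals all_analysis.

Set Implicit Arguments.
Unset Strict Implicit.
Unset Printing Implicit Defensive.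

Import Order.TTheory GRing.Theory Num.Theory.
Import numFieldNormedType.Exports.

Local Open Scope classical_set_scope.
Local Open Scope ring_scope.

(* {0, ..., N-1} with N = n.+1 and the discrete topology and sigma-algebra;
   measurable types are pointed, whence the successor. *)
Notation chi n := 'I_n.+1.

HB.instance Definition _ n := isPointed.Build (chi n) ord0.

HB.instance Definition _ n := @isMeasurable.Build default_measure_display
  (chi n) discrete_measurable discrete_measurable0
  discrete_measurableC discrete_measurableU.

HB.instance Definition _ n := hasNbhs.Build (chi n) principal_filter.
HB.instance Definition _ n := Discrete_ofNbhs.Build (chi n) erefl.

Definition mutually_independent {d d'} {T : measurableType d}
    {S : measurableType d'} {R : realType} (P : probability T R)
    (X : nat -> {RV P >-> S}) : Prop :=
  forall (J : {fset nat}) (A : nat -> set S), (forall i, measurable (A i)) ->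
    P (\bigcap_(i in [set` J]) (X i @^-1` A i))
    = (\prod_(i <- J) P (X i @^-1` A i))%E.

Definition identically_distributed {d d1 d2} {T1 : measurableType d1}
    {T2 : measurableType d2} {S : measurableType d} {R : realType}
    (P1 : probability T1 R) (P2 : probability T2 R)
    (X1 : {RV P1 >-> S}) (X2 : {RV P2 >-> S}) : Prop :=
  forall A : set S, measurable A -> distribution P1 X1 A = distribution P2 X2 A.

(* A sequence of independent copies of X may live on a probability space other
   than the one carrying X. *)
Definition independent_copies {d d1 d2} {T1 : measurableType d1}
    {T2 : measurableType d2} {S : measurableType d} {R : realType}
    (P1 : probability T1 R) (P2 : probability T2 R)
    (X : {RV P1 >-> S}) (Y : nat -> {RV P2 >-> S}) : Prop :=
  mutually_independent Y /\ forall i, identically_distributed (Y i) X.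

(* ord0 is neutral for max, so it only shows up as the empty maximum. *)
Definition partial_max {T : Type} {n : nat} (Y : nat -> T -> chi n) (m : nat)
    (t : T) : chi n :=
  \big[Order.max/ord0]_(i < m) Y i t.

(* Every f is continuous and bounded here, but both hypotheses are kept so that
   this reads as the usual definition of weak convergence.  Every Z m considered
   below is measurable, as a maximum of random variables. *)
Definition cvg_in_distribution {d} {T : measurableType d} {R : realType}
    (P : probability T R) {n : nat} (Z : nat -> T -> chi n)
    (mu : probability (chi n) R) : Prop :=
  forall f : chi n -> R, continuous f -> bounded_fun f ->
    'E_P[f \o Z m]%E @[m --> \oo] --> 'E_mu[f]%E.

(* The law of partial_max Y m depends only on that of X, so the choice of the
   independent copies is immaterial. *)
Definition in_domain_of_attraction {d} {T : measurableType d} {R : realType}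
    (P : probability T R) {n : nat} (X : {RV P >-> chi n})
    (mu : probability (chi n) R) : Prop :=
  exists (d' : measure_display) (T' : measurableType d')
         (P' : probability T' R) (Y : nat -> {RV P' >-> chi n}),
    independent_copies X Y /\ cvg_in_distribution P' (partial_max Y) mu.

(* Main.v *)
From HB Require Import structures.
Require Import Defs.
From mathcomp Require Import all_boot all_order all_algebra finmap.
From mathcomp Require Import all_classical all_reals all_analysis.
From mathcomp Require Import measurable_realfun.

Import Order.TTheory GRing.Theory Num.Theory.
Import numFieldNormedType.Exports.

Local Open Scope classical_set_scope.
Local Open Scope ring_scope.

(** Write M_m for the maximum of m independent copies Y_i of X.  On a finite
    discrete space, convergence in distribution of M_m to the point mass at x
    means that P(M_m in A) tends to 1 or to 0 according to whether A contains x
    ([cvg_in_distribution_chiP]).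

    Necessity.  For m >= 1, P(X > x) = P(Y_0 > x) <= P(M_m > x), which tends to
    0.  The maximum is attained, so if P(X = x) = 0, then P(M_m = x) = 0 for all
    m >= 1, although this probability should tend to 1.

    Sufficiency.  Almost surely no Y_i exceeds x; then M_m differs from x only
    if none of the first m copies equals x, an event of probability
    P(X <> x) ^ m, which tends to 0.

    The second half also requires a sequence of independent copies of X to
    exist.  It is produced on ]0, 1] with Lebesgue measure.  The quantile
    function g of the law of X cuts ]0, 1] into intervals, one for each value k,
    of length P(X = k); the shift stretches each of them affinely onto ]0, 1].
    Scaling of Lebesgue measure shows that g has the law of X and that the shift
    is independent of g and again uniform ([lebesgue01_coding]), so the values
    of g along the iterates of the shift are independent with the law of X
    ([independent_copies_coding]). *)

(** * Random variables with values in a finite chain *)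

Lemma measurable_fun_chi {d} {T : measurableType d} {n : nat} (f : T -> chi n) :
  (forall k, measurable (f @^-1` [set k])) -> measurable_fun setT f.
Proof.
move=> mf _ A _; rewrite setTI.
rewrite (_ : _ @^-1` _ = \bigcup_(k in A) f @^-1` [set k]).
  by apply: fin_bigcup_measurable => //; exact: finite_finset.
apply/seteqP; split => [t At|t [k Ak tk]]; first by exists (f t).
by rewrite /preimage /= (tk : f t = k).
Qed.

Lemma measurable_preimage_chi {d} {T : measurableType d} {n : nat}
    (f : T -> chi n) (A : set (chi n)) :
  measurable_fun setT f -> measurable (f @^-1` A).
Proof. by move=> mf; rewrite -[X in measurable X]setTI; exact: mf. Qed.

Lemma measurable_fun_chi2 {d} {T : measurableType d} {n : nat}
    (op : chi n -> chi n -> chi n) (f g : T -> chi n) :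
  measurable_fun setT f -> measurable_fun setT g ->
  measurable_fun setT (fun t => op (f t) (g t)).
Proof.
move=> mf mg; apply: measurable_fun_chi => k.
rewrite (_ : _ @^-1` _ =
  \bigcup_i (f @^-1` [set i] `&` g @^-1` [set j | op i j = k])).
  apply: fin_bigcup_measurable => [|i _]; first exact: finite_finset.
  by apply: measurableI; exact: measurable_preimage_chi.
apply/seteqP; split => [t /= At|t [i _ [fi gi]]]; first by exists (f t).
by rewrite /preimage /= (fi : f t = i).
Qed.

Lemma measurable_partial_max {d} {T : measurableType d} {n : nat}
    (Y : nat -> T -> chi n) (m : nat) :
  (forall i, measurable_fun setT (Y i)) ->
  measurable_fun setT (partial_max Y m).
Proof.
elim: m Y => [|m IHm] Y mY.
  rewrite (_ : partial_max Y 0 = cst ord0); first exact: measurable_cst.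
  by apply/funext => t; rewrite /partial_max big_ord0.
rewrite (_ : partial_max Y m.+1 =
  fun t => Order.max (Y 0 t) (partial_max (Y \o S) m t)).
  by apply: measurable_fun_chi2 => //; apply: IHm => i; exact: mY.
by apply/funext => t; rewrite /partial_max big_ord_recl.
Qed.

Lemma continuous_chi {n : nat} {R : realType} (f : chi n -> R) : continuous f.
Proof.
move=> k A /nbhs_singleton Afk.
by rewrite /nbhs /=; apply/principal_filterP.
Qed.

Lemma bounded_chi {n : nat} {R : realType} (f : chi n -> R) : bounded_fun f.
Proof.
exists (\sum_k `|f k|); split; first by rewrite num_real.
move=> M ltM k _ /=; apply: le_trans (ltW ltM).
by rewrite (bigD1 k) //= lerDl sumr_ge0.
Qed.

(** The expectation as a finite sum over the values of [Z]. *)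
Lemma expectation_chi {d} {T : measurableType d} {R : realType}
    (P : probability T R) {n : nat} (Z : T -> chi n) (f : chi n -> R) :
  measurable_fun setT Z ->
  'E_P[f \o Z]%E = (\sum_k f k * fine (P (Z @^-1` [set k])))%:E.
Proof.
move=> mZ; rewrite unlock.
have mpre k : measurable (Z @^-1` [set k]) by exact: measurable_preimage_chi.
transitivity (\int[P]_w (\sum_k ((f k)%:E * (\1_(Z @^-1` [set k]) w)%:E)))%E.
  apply: eq_integral => w _ /=.
  rewrite (bigD1 (Z w)) //= big1 ?adde0 => [|k kZ].
    by rewrite indicE mem_set // mule1.
  by rewrite indicE memNset ?mule0 //= => E; rewrite E eqxx in kZ.
rewrite integral_sum //; last first.
  by move=> k; apply: integrableZl => //; exact: integrable_indic.
rewrite -sumEFin; apply: eq_bigr => k _.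
rewrite integralZl //; last exact: integrable_indic.
by rewrite integral_indic // setIT EFinM fineK // fin_num_measure.
Qed.

(** On a finite discrete space every function is a bounded continuous test
    function, so weak convergence is convergence of the probability of every
    event: indicators give one direction, [expectation_chi] the other. *)
Lemma cvg_in_distribution_chiP {d} {T : measurableType d} {R : realType}
    (P : probability T R) {n : nat} (Z : nat -> T -> chi n)
    (mu : probability (chi n) R) :
  (forall m, measurable_fun setT (Z m)) ->
  cvg_in_distribution P Z mu <->
  forall A, P (Z m @^-1` A) @[m --> \oo] --> mu A.
Proof.
move=> mZ; split => [Zmu A|Zmu f _ _].
  have := Zmu (\1_A) (@continuous_chi _ _ _) (@bounded_chi _ _ _).
  rewrite expectation_indic //.
  under eq_fun => m.
    rewrite (_ : _ \o _ = \1_(Z m @^-1` A)) //.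
    rewrite expectation_indic; last exact: measurable_preimage_chi.
    over.
  by [].
rewrite (_ : 'E_mu[f] = (\sum_k f k * fine (mu [set k]))%:E)%E; last first.
  exact: (@expectation_chi _ _ _ mu n id).
under eq_fun do rewrite expectation_chi //.
apply: cvg_EFin; first exact: nearW.
apply: cvg_big => [|k _]; first exact: add_continuous.
apply: cvgMr.
apply: fine_cvg.
rewrite fineK ?fin_num_measure //; exact: Zmu.
Qed.

(** * The partial maxima *)

Lemma le_partial_max {T : Type} {n : nat} (Y : nat -> T -> chi n) (m i : nat)
  (t : T) : (i < m)%N -> (Y i t <= partial_max Y m t)%O.
Proof.
move=> im.
exact: (@le_bigmax _ _ _ ord0 (fun i : 'I_m => Y i t) (Ordinal im)).
Qed.

(** The empty maximum is [ord0], which need not be a value of [Y]. *)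
Lemma partial_max_attained {T : Type} {n : nat} (Y : nat -> T -> chi n)
  (m : nat) (t : T) : (0 < m)%N -> exists i, partial_max Y m t = Y i t.
Proof.
elim: m Y => // m IHm Y _.
rewrite /partial_max big_ord_recl maxElt; case: ifP => [Y0|_]; last first.
  by exists 0%N.
case: m IHm Y0 => [_|m IHm _].
  by rewrite big_ord0 ltNge leEord.
have [i Yi] := IHm (Y \o S) isT.
by exists i.+1; exact: Yi.
Qed.

Lemma partial_max_eq {T : Type} {n : nat} (Y : nat -> T -> chi n) (m i : nat)
    (t : T) (x : chi n) :
  (forall j, (Y j t <= x)%O) -> (i < m)%N -> Y i t = x -> partial_max Y m t = x.
Proof.
move=> Yx im Yit; apply/le_anti/andP; split; last first.
  by rewrite -Yit le_partial_max.
by apply: bigmax_le => [|j _]; [rewrite leEord|exact: Yx].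
Qed.

(** * A probability measure on a finite chain and its quantile function *)

Lemma measure_preimage_chi {d} {T : measurableType d} {R : realType}
    (mu : {measure set T -> \bar R}) {n : nat} (f : T -> chi n)
    (A : set (chi n)) (C : set T) :
  measurable_fun setT f -> measurable C ->
  mu (f @^-1` A `&` C) = (\sum_(k | k \in A) mu (f @^-1` [set k] `&` C))%E.
Proof.
move=> mf mC; rewrite -measure_bigsetU_ord.
- congr (mu _); rewrite -bigcup_seq_cond; apply/seteqP; split=> t.
    by move=> [At Ct]; exists (f t) => //=; rewrite mem_index_enum mem_set.
  move=> [k /= /andP[_ /set_mem Ak] [tk Ct]].
  by split; rewrite // /preimage /= tk.
- by move=> k; apply: measurableI => //; exact: measurable_preimage_chi.
- by move=> i j _ _ [t [[/= <- _] [/= <- _]]].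
Qed.

Lemma probability_chiE {n : nat} {R : realType} (mu : probability (chi n) R)
    (A : set (chi n)) : mu A = (\sum_(k | k \in A) mu [set k])%E.
Proof.
rewrite -[A in mu A]setIT (@measure_preimage_chi _ _ _ mu n id) //.
by apply: eq_bigr => k _; rewrite setIT.
Qed.

(** The left-continuous distribution function: [cdf_chi mu j] is the mass of
    [{i | i < j}], so that the atom at [k] is
    [cdf_chi mu k.+1 - cdf_chi mu k]. *)
Definition cdf_chi {n : nat} {R : realType} (mu : probability (chi n) R)
  (j : nat) : R := \sum_(i : chi n | (i < j)%N) fine (mu [set i]).

Section Cdf.
Context {n : nat} {R : realType} (mu : probability (chi n) R).
Local Notation F := (cdf_chi mu).
Local Notation p k := (fine (mu [set k])).

Lemma cdf_chi0 : F 0 = 0.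
Proof. by rewrite /cdf_chi big_pred0. Qed.

Lemma cdf_chiS (k : chi n) : F k.+1 = F k + p k.
Proof.
rewrite /cdf_chi (bigD1 k) //= addrC; congr (_ + _).
by apply: eq_bigl => i; rewrite ltnS ltn_neqAle andbC.
Qed.

Lemma cdf_chi_total : F n.+1 = 1.
Proof.
apply: EFin_inj; rewrite /cdf_chi -sumEFin -(probability_setT mu).
rewrite probability_chiE.
apply: eq_big => [i|i _]; first by rewrite ltn_ord in_setT.
by rewrite fineK // fin_num_measure.
Qed.

Lemma cdf_chi_nd (i j : nat) : (i <= j)%N -> F i <= F j.
Proof.
move=> ij; rewrite /cdf_chi [leRHS]big_mkcond [leLHS]big_mkcond.
apply: ler_sum => k _; case: ifP => ki; last first.
  by case: ifP => // _; exact: fine_ge0.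
by rewrite (leq_trans ki ij).
Qed.
End Cdf.

(** The quantile function: [quantile_chi mu t] is the largest [k] such that
    [cdf_chi mu k < t], and [ord0] when there is none.  Only its values on
    ]0, 1] matter. *)
Definition quantile_chi {n : nat} {R : realType} (mu : probability (chi n) R) :
    measurableTypeR R -> chi n :=
  partial_max (fun i t => if cdf_chi mu i < t then inord i else ord0) n.+1.

Section Quantile.
Context {n : nat} {R : realType} (mu : probability (chi n) R).
Local Notation F := (cdf_chi mu).
Local Notation g := (quantile_chi mu).

Lemma measurable_quantile_chi : measurable_fun setT g.
Proof.
apply: measurable_partial_max => i.
apply: measurable_fun_ifT => //.
exact: measurable_fun_ltr.
Qed.

Lemma quantile_chiP (t : R) (k : chi n) : 0 < t <= 1 ->
  g t = k <-> F k < t <= F k.+1.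
Proof.
move=> /andP[t0 t1].
have gt : F (g t) < t.
  rewrite /quantile_chi /partial_max; apply: (big_ind (fun k : chi n => F k < t)).
  - by rewrite cdf_chi0.
  - by move=> i j ? ?; rewrite maxElt; case: ifP.
  - by move=> i _; case: ifP; rewrite ?cdf_chi0 // inord_val.
have tg : t <= F (g t).+1.
  rewrite leNgt; apply/negP => ltg.
  have gn : ((g t).+1 < n.+1)%N.
    rewrite ltnNge; apply/negP => ng.
    have := lt_le_trans ltg t1.
    by rewrite ltNge -(cdf_chi_total mu) cdf_chi_nd.
  have := @le_bigmax _ _ _ ord0 (fun i : 'I_n.+1 =>
    if F i < t then inord i else ord0 : chi n) (Ordinal gn).
  rewrite /= ltg -[X in (_ <= X)%O]/(g t) leEord /= inordK //.
  by rewrite ltnn.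
split=> [<-|/andP[kt tk]]; first by rewrite gt.
(* The intervals ]F k, F k.+1] are pairwise disjoint. *)
have sep (i j : chi n) : (i < j)%N -> F j < t -> t <= F i.+1 -> False.
  by move=> ij jt ti; have := lt_le_trans jt ti; rewrite ltNge cdf_chi_nd.
apply/val_inj => /=.
case: (ltngtP (g t) k) => // [gk|kg]; exfalso.
  exact: sep gk kt tg.
exact: sep kg gt tk.
Qed.

End Quantile.

(** * An independent identically distributed sequence on ]0, 1] *)

Lemma lebesgue_measure_affine_preimage {R : realType} (a c : R) (B : set R) :
  0 < c -> measurable B ->
  lebesgue_measure ((fun t => (t - a) / c) @^-1` B)
    = (c%:E * lebesgue_measure B)%E.
Proof.
move=> c0 mB.
pose phi : measurableTypeR R -> measurableTypeR R := fun t => (t - a) / c.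
have mphi : measurable_fun setT phi.
  by apply: measurable_funM => //; exact: measurable_funB.
have ci0 : 0 <= c^-1 by rewrite invr_ge0 ltW.
(* Lebesgue measure is characterised by its values on half-open intervals, and
   the image of Lebesgue measure under phi, divided by c, has these values. *)
pose nu : {measure set (measurableTypeR R) -> \bar R} :=
  mscale (NngNum ci0) (pushforward lebesgue_measure phi).
rewrite (@lebesgue_measure_unique _ (nu mphi) _ B) //.
  by rewrite /nu /= /mscale /= muleA -EFinM divff ?gt_eqF // mul1e.
move=> _ [[u v] _ <-]; rewrite /nu /= /mscale /= /pushforward.
rewrite (_ : _ @^-1` _ = `]a + c * u, a + c * v]%classic).
  rewrite !lebesgue_measure_itv /= !lte_fin ltrD2l ltr_pM2l //.
  case: ifP => _; last by rewrite mule0.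
  rewrite -!EFinD -EFinM opprD addrACA subrr add0r -mulrBr.
  by rewrite mulKf // gt_eqF.
apply/seteqP; split => t /=; rewrite !in_itv /=;
  by rewrite ltr_pdivlMr // ler_pdivrMr // ltrBrDl lerBlDl ![_ * c]mulrC.
Qed.

Lemma measurable_itv01 {R : realType} :
  measurable (`]0, 1]%classic : set (measurableTypeR R)).
Proof. exact: measurable_itv. Qed.

(** Lebesgue measure concentrated on ]0, 1], as a measure on the whole line;
    the half-open interval matches the intervals on which the quantile function
    is constant. *)
Definition lebesgue01 {R : realType} : set (measurableTypeR R) -> \bar R :=
  mrestr lebesgue_measure measurable_itv01.

HB.instance Definition _ (R : realType) := Measure.on (@lebesgue01 R).

Lemma lebesgue01_setT {R : realType} : @lebesgue01 R setT = 1%E.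
Proof.
by rewrite /lebesgue01 /mrestr setTI lebesgue_measure_itv /= lte_fin ltr01 sube0.
Qed.

HB.instance Definition _ (R : realType) :=
  Measure_isProbability.Build _ _ _ (@lebesgue01 R) lebesgue01_setT.

Section Coding.
Context {n : nat} {R : realType} (mu : probability (chi n) R).
Local Notation F := (cdf_chi mu).
Local Notation g := (quantile_chi mu).
Local Notation p k := (fine (mu [set k])).

(** The affine map that stretches each interval ]F k, F k.+1] of positive length
    onto ]0, 1]. *)
Definition coding_shift (t : measurableTypeR R) : measurableTypeR R :=
  (t - F (g t)) / p (g t).

Lemma measurable_coding_shift : measurable_fun setT coding_shift.
Proof.
have mg (h : chi n -> R) : measurable_fun setT (h \o g).
  by apply: measurableT_comp; [move=> _ A _|exact: measurable_quantile_chi].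
apply: measurable_funM; first apply: measurable_funB => //.
  exact: (mg (fun k : chi n => F k)).
exact: (mg (fun k => (p k)^-1)).
Qed.

(** Under [lebesgue01], [g t] has law [mu], and [coding_shift t] is independent
    of it and again uniform on ]0, 1]. *)
Lemma lebesgue01_coding (k : chi n) (B : set (measurableTypeR R)) :
  measurable B ->
  lebesgue01 (g @^-1` [set k] `&` coding_shift @^-1` B)
  = (mu [set k] * lebesgue01 B)%E.
Proof.
move=> mB; rewrite /lebesgue01 /mrestr /=.
rewrite -[mu [set k]]fineK ?fin_num_measure //.
have in01 (t : R) : F k < t <= F k.+1 -> 0 < t <= 1.
  move=> /andP[kt tk]; apply/andP; split.
    by apply: le_lt_trans kt; rewrite -(cdf_chi0 mu) cdf_chi_nd.
  by apply: le_trans tk _; rewrite -(cdf_chi_total mu) cdf_chi_nd.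
(* When p k = 0 the shift divides by zero, but then g sends no point of ]0, 1]
   to k. *)
have : 0 <= p k by exact: fine_ge0.
rewrite le_eqVlt => /predU1P[p0|p_gt0].
  rewrite -p0 mul0e (_ : _ `&` _ = set0) ?measure0 //.
  rewrite -subset0 => t [[gt _]] /=; rewrite in_itv /= => t01.
  have := (quantile_chiP mu t k t01).1 gt.
  by rewrite cdf_chiS -p0 addr0 lt_le_asym.
rewrite -(lebesgue_measure_affine_preimage (F k)) //; last first.
  by apply: measurableI => //; exact: measurable_itv01.
congr (lebesgue_measure _); apply/seteqP; split => t.
  move=> [[/= gt]]; rewrite /coding_shift gt => Bt.
  rewrite in_itv /= => t01; split => //=; rewrite in_itv /=.
  have /andP[kt tk] := (quantile_chiP mu t k t01).1 gt.
  by rewrite divr_gt0 ?subr_gt0 //= ler_pdivrMr // mul1r lerBlDl -cdf_chiS.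
move=> [/= Bt]; rewrite in_itv /= => /andP[].
rewrite pmulr_lgt0 ?invr_gt0 // subr_gt0 ler_pdivrMr // mul1r lerBlDl -cdf_chiS.
move=> kt tk.
have Ft : F k < t <= F k.+1 by rewrite kt.
have gt : g t = k by apply/(quantile_chiP mu t k (in01 t Ft)).
by split; [split => //=; rewrite /coding_shift gt | rewrite /= in_itv /= in01].
Qed.

(** The expansion of a point of ]0, 1] with respect to [mu]: its [i]-th digit is
    the quantile of the [i]-th iterate of the shift.  For [mu] uniform on
    {0, ..., N-1} these are the digits in
    base N of the expansion that does not end in zeros. *)
Definition coding (i : nat) (t : measurableTypeR R) : chi n :=
  g (iter i coding_shift t).

Lemma measurable_coding (i : nat) : measurable_fun setT (coding i).
Proof.
apply: measurableT_comp; first exact: measurable_quantile_chi.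
elim: i => [|i IHi]; first exact: measurable_id.
by apply: measurableT_comp IHi; exact: measurable_coding_shift.
Qed.

(** Joint law of the first [m] digits, by induction on [m]: the event depends on
    the first digit and on the first [m - 1] digits of the shifted point. *)
Lemma lebesgue01_cylinder (m : nat) (A : nat -> set (chi n)) :
  lebesgue01 (\bigcap_(i in `I_m) (coding i @^-1` A i))
  = (\prod_(i < m) mu (A i))%E.
Proof.
elim: m A => [|m IHm] A.
  by rewrite big_ord0 -lebesgue01_setT; congr lebesgue01; apply/seteqP; split.
rewrite big_ord_recl /= -(IHm (A \o S)).
set C := \bigcap_(i in `I_m) _.
have mC : measurable C.
  apply: bigcap_measurableType => i _.
  by apply: measurable_preimage_chi; exact: measurable_coding.
have mSC : measurable (coding_shift @^-1` C).
  by rewrite -[X in measurable X]setTI; exact: measurable_coding_shift.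
rewrite (_ : \bigcap_(i in `I_m.+1) _ = g @^-1` A 0%N `&` coding_shift @^-1` C).
  rewrite (@measure_preimage_chi _ _ _ lebesgue01) //; last first.
    exact: measurable_quantile_chi.
  rewrite probability_chiE ge0_sume_distrl //.
  by apply: eq_bigr => k _; exact: lebesgue01_coding.
apply/seteqP; split=> t.
  move=> At; split; first exact: (At 0%N).
  by move=> i im; have := At i.+1 im; rewrite /preimage /coding /= -iterS iterSr.
move=> [At Ct] [|i] im //; have := Ct i im.
by rewrite /preimage /coding /= -iterS iterSr.
Qed.

(** From initial segments to arbitrary finite index sets, by imposing no
    condition on the missing indices. *)
Lemma lebesgue01_coding_fset (J : {fset nat}) (A : nat -> set (chi n)) :
  lebesgue01 (\bigcap_(i in [set` J]) (coding i @^-1` A i))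
  = (\prod_(i <- J) mu (A i))%E.
Proof.
pose m := (\max_(i <- J) i).+1.
have Jm i : i \in J -> (i < m)%N.
  by move=> iJ; rewrite ltnS; apply: (leq_bigmax_seq i).
pose A' i := if i \in J then A i else setT.
rewrite (_ : \bigcap_(i in _) _ = \bigcap_(i in `I_m) (coding i @^-1` A' i)).
  rewrite lebesgue01_cylinder -(big_mkord xpredT (fun i => mu (A' i))).
  transitivity (\prod_(i <- index_iota 0 m | i \in J) mu (A i))%E.
    rewrite [RHS]big_mkcond; apply: eq_bigr => i _; rewrite /A'.
    by case: ifP => // _; exact: probability_setT.
  rewrite -big_filter; apply: perm_big; apply: uniq_perm.
  - by rewrite filter_uniq // iota_uniq.
  - exact: fset_uniq.
  move=> i; rewrite mem_filter mem_index_iota /=.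
  by case: (boolP (i \in J)) => // /Jm ->.
apply/seteqP; split => t At i /=.
  by move=> im; rewrite /preimage /A' /=; case: ifP => // /At.
by move=> iJ; have := At i (Jm i iJ); rewrite /preimage /A' /= iJ.
Qed.

HB.instance Definition _ i :=
  isMeasurableFun.Build _ _ _ _ (coding i) (measurable_coding i).

End Coding.

(** The digits as random variables on the line with [lebesgue01]. *)
Definition coding_rv {n : nat} {R : realType} (mu : probability (chi n) R)
    (i : nat) : {RV (@lebesgue01 R) >-> chi n} :=
  coding mu i : {mfun measurableTypeR R >-> chi n}.

Lemma independent_copies_coding {d} {T : measurableType d} {R : realType}
    (P : probability T R) {n : nat} (X : {RV P >-> chi n}) :
  independent_copies X (coding_rv (distribution P X)).
Proof.
have fE := lebesgue01_coding_fset (distribution P X).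
have mE i A :
    lebesgue01 (coding (distribution P X) i @^-1` A) = distribution P X A.
  have := fE [fset i]%fset (fun=> A).
  by rewrite big_seq_fset1 set_fset1 bigcap_set1.
split=> [J A _|i A _]; last exact: mE.
transitivity (\prod_(i <- J) distribution P X (A i))%E; first exact: fE.
by apply: eq_bigr => i _; exact/esym/mE.
Qed.

(** * The domain of attraction of a point mass *)

Section Domain.
Context {n : nat} (x : chi n) {R : realType} {d : measure_display}
  {T : measurableType d} (P : probability T R) (X : {RV P >-> chi n}).

Lemma domain_of_attraction_dirac_necessary :
  in_domain_of_attraction X (\d_x : probability (chi n) R) ->
  P (X @^-1` [set y | (x < y)%O]) = 0%E /\ (0 < P (X @^-1` [set x]))%E.
Proof.
move=> [d' [T' [P' [Y [[_ YX]]]]]].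
have mY i : measurable_fun setT (Y i) by exact: measurable_funPT.
have mM m : measurable_fun setT (partial_max Y m).
  exact: measurable_partial_max.
move=> /(cvg_in_distribution_chiP P' _ _ mM) cvgM.
have YXE i A : P' (Y i @^-1` A) = P (X @^-1` A) by exact: YX.
split.
  rewrite -(YXE 0%N); apply/eqP; rewrite -measure_le0.
  have := cvgM [set y | (x < y)%O].
  rewrite /= diracE memNset /= ?ltxx // => cvg0.
  apply: (cvge_ge _ cvg0); exists 1%N => // m /= m_gt0.
  apply: le_measure; rewrite ?inE; try exact: measurable_preimage_chi.
  by move=> t xY; exact: lt_le_trans xY (le_partial_max Y m 0 t m_gt0).
(* If X avoided x almost surely, so would every copy, hence every maximum of at
   least one copy, whereas the probability that the maximum is x tends to 1. *)
rewrite lt0e measure_ge0 andbT; apply/eqP => X0.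
pose N := \bigcup_i (Y i @^-1` [set x]).
have mN : measurable N.
  by apply: bigcupT_measurable => i; exact: measurable_preimage_chi.
have N0 : P' N = 0%E.
  apply/negligibleP => //; apply: negligible_bigcup => i.
  apply/negligibleP; first exact: measurable_preimage_chi.
  exact: etrans (YXE i _) X0.
have := cvgM [set x]; rewrite /= diracE mem_set //= => cvg1.
have : (1%E <= 0%E :> \bar R)%E.
  apply: (cvge_le _ cvg1); exists 1%N => // m /= m_gt0.
  rewrite -N0; apply: le_measure; rewrite ?inE //.
    exact: measurable_preimage_chi.
  move=> t Mx; have [i Mi] := partial_max_attained Y m t m_gt0.
  by exists i => //=; rewrite -Mi.
by rewrite lee_fin ler10.
Qed.

Lemma domain_of_attraction_dirac_sufficient :
  P (X @^-1` [set y | (x < y)%O]) = 0%E -> (0 < P (X @^-1` [set x]))%E ->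
  in_domain_of_attraction X (\d_x : probability (chi n) R).
Proof.
move=> Xgt0 Xx.
pose P' : probability (measurableTypeR R) R := lebesgue01.
pose Y : nat -> {RV P' >-> chi n} := coding_rv (distribution P X).
have YX : independent_copies X Y by exact: independent_copies_coding.
exists _, _, P', Y; split => //.
have YXE i A : P' (Y i @^-1` A) = P (X @^-1` A) by exact: YX.2.
have mY i : measurable_fun setT (Y i) by exact: measurable_funPT.
have mM m : measurable_fun setT (partial_max Y m).
  exact: measurable_partial_max.
apply/(cvg_in_distribution_chiP P' _ _ mM).
pose N := \bigcup_i (Y i @^-1` [set y | (x < y)%O]).
have mN : measurable N.
  by apply: bigcupT_measurable => i; exact: measurable_preimage_chi.
have N0 : P' N = 0%E.
  apply/negligibleP => //; apply: negligible_bigcup => i.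
  apply/negligibleP; first exact: measurable_preimage_chi.
  exact: etrans (YXE i _) Xgt0.
(* C m is the event that none of the first m copies equals x. *)
pose C m := \bigcap_(i in `I_m) (Y i @^-1` (~` [set x])).
have mC m : measurable (C m).
  by apply: bigcap_measurableType => i _; exact: measurable_preimage_chi.
have PX_fin A : P (X @^-1` A) \is a fin_num.
  by apply: fin_num_measure; exact: measurable_preimage_chi.
pose q := fine (P (X @^-1` (~` [set x]))).
have C_pow m : P' (C m) = (q ^+ m)%:E.
  transitivity (\prod_(i < m) distribution P X (~` [set x]))%E.
    exact: lebesgue01_cylinder.
  transitivity (\prod_(i < m) q%:E)%E.
    by apply: eq_bigr => i _; rewrite fineK.
  by rewrite prodEFin prodr_const card_ord.
have q_ge0 : 0 <= q by exact: fine_ge0.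
have q_lt1 : q < 1.
  rewrite -lte_fin fineK // -preimage_setC probability_setC; last first.
    exact: measurable_preimage_chi.
  by rewrite -[P _]fineK // -EFinB lte_fin gtrBl -lte_fin fineK.
have cvg_pow : (q ^+ m)%:E @[m --> \oo] --> 0%E.
  by apply: cvg_EFin; [exact: nearW | apply: cvg_expr; rewrite ger0_norm].
(* Outside the null event N the maximum can only differ from x on C m. *)
have cvg0 A : ~ A x -> P' (partial_max Y m @^-1` A) @[m --> \oo] --> 0%E.
  move=> nAx.
  apply: (squeeze_cvge _ (cvg_cst _) cvg_pow); apply: nearW => m.
  rewrite measure_ge0 /= -C_pow -[leRHS]add0e -N0.
  apply: le_trans (measureU2 _ mN (mC m)).
  apply: le_measure; rewrite ?inE.
  - exact: measurable_preimage_chi.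
  - exact: measurableU.
  move=> t At; have [Nt|nNt] := pselect (N t); [by left|right].
  move=> i im Yx; apply: nAx.
  suff <- : partial_max Y m t = x by [].
  apply: (@partial_max_eq _ _ Y m i) => // j.
  by rewrite leNgt; apply/negP => xY; apply: nNt; exists j.
move=> A; rewrite /= diracE; have [Ax|nAx] := pselect (A x); last first.
  by rewrite memNset //=; exact: cvg0.
rewrite mem_set //=.
have -> : (fun m => P' (partial_max Y m @^-1` A)) =
    (fun m => 1 - P' (partial_max Y m @^-1` (~` A)))%E.
  apply/funext => m; rewrite -probability_setC; last first.
    exact: measurable_preimage_chi.
  by rewrite preimage_setC setCK.
rewrite -[X in _ --> X]sube0; apply: cvgeB => //; first exact: cvg_cst.
by apply: cvg0; apply.
Qed.
End Domain.

Theorem theorem8 (n : nat) (x : chi n) (R : realType)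
    (d : measure_display) (T : measurableType d) (P : probability T R)
    (X : {RV P >-> chi n}) :
  in_domain_of_attraction X (\d_x : probability (chi n) R) <->
  P (X @^-1` [set y | (x < y)%O]) = 0%E /\ (0 < P (X @^-1` [set x]))%E.
Proof.
split; first exact: domain_of_attraction_dirac_necessary.
by move=> [Xgt0 Xx]; exact: domain_of_attraction_dirac_sufficient.
Qed.
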